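(* The transition function $f_P$ of the ATO-POS system with individual state-dependent replenishments is monotone under the natural product order on $\mathcal{X}$, i.e. for all $a\in\mathcal{E}$ and all $x,y\in\mathcal{X}$, $$x\le y\ \Longrightarrow\ f_P(x,a)\le f_P(y,a).$$
   Context: Let $I\ge 1$ be an integer, $\mathcal{I}=\{1,\dots,I\}$, and let $C_1,\dots,C_I$ be positive integers. The state space is $\mathcal{X}=\{0,\dots,C_1\}\times\cdots\times\{0,\dots,C_I\}$, with the product order: $x\le y$ iff $x_i\le y_i$ for all $i\in\mathcal{I}$. Let $e_i$ be the vector with all components $0$ except the $i$-th, equal to $1$. Service rates: for each $i\in\mathcal{I}$, $\mu_i:\{0,\dots,C_i\}\to[0,\infty)$ with $\mu_i(0)=0$ and $\mu_i(x)>0$ for $x\ge 1$ (arbitrary otherwise, not assumed monotone). Let $\ell_i=(\ell_i^{(0)},\dots,\ell_i^{(C_i)})$ be an ordering (permutation) of $\{0,\dots,C_i\}$ with $0=\mu_i(\ell_i^{(0)})\le\mu_i(\ell_i^{(1)})\le\dots\le\mu_i(\ell_i^{(C_i)})$. Events: $\mathcal{E}=\{d_A: \emptyset\ne A\subset\mathcal{I}\}\cup\{s_i^{(j)}: i\in\mathcal{I},1\le j\le C_i\}$ ($d_A$ is a joint arrival to the queues in $A$, $s_i^{(j)}$ a service in queue $i$). The transition function $f_P:\mathcal{X}\times\mathcal{E}\to\mathcal{X}$ of the ATO-POS (assemble-to-order, partial order service) system is $$f_P(x,d_A)=x+\sum_{k\in A}\mathbf{1}_{\{x_k<C_k\}}e_k,\qquad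 f_P(x,s_i^{(j)})=x-\sum_{k=j}^{C_i}\mathbf{1}_{\{x_i=\ell_i^{(k)}\}}e_i .$$ *)

(* Defs.v *)
From HB Require Import structures.
From mathcomp Require Import all_boot all_order all_fingroup all_algebra reals.

Set Implicit Arguments.
Unset Strict Implicit.
Unset Printing Implicit Defensive.

Import Order.TTheory GRing.Theory Num.Theory.
Local Open Scope ring_scope.

(** Queues are indexed by ['I_n], i.e. from [0] to [n - 1]. *)

(** The state space, cut out of the integer vectors so that [x + e_k] and
    [x - e_k] are computed in Z^n, without truncated subtraction. *)
Definition in_box n (C : 'I_n -> nat) (v : 'rV[int]_n) : bool :=
  [forall i, 0 <= v 0 i <= (C i)%:Z].

Record state n (C : 'I_n -> nat) := State {
  state_vec :> 'rV[int]_n;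
  state_in_box : in_box C state_vec
}.

HB.instance Definition _ n (C : 'I_n -> nat) :=
  [isSub for @state_vec n C].
HB.instance Definition _ n (C : 'I_n -> nat) := [Choice of state C by <:].

Section ProductOrder.
Variables (n : nat) (C : 'I_n -> nat).
Implicit Types x y z : state C.

Definition state_le x y : bool := [forall i, x 0 i <= y 0 i].

Lemma state_le_refl : reflexive state_le.
Proof. by move=> x; apply/forallP. Qed.

Lemma state_le_anti : antisymmetric state_le.
Proof.
move=> x y /andP[/forallP xy /forallP yx]; apply/val_inj/rowP => i.
by apply/le_anti; rewrite xy yx.
Qed.

Lemma state_le_trans : transitive state_le.
Proof.
move=> y x z /forallP xy /forallP yz; apply/forallP => i.
exact: le_trans (xy i) (yz i).
Qed.

HB.instance Definition _ :=
  Order.Le_isPOrder.Build (Order.Disp tt tt) (state C)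
    state_le_refl state_le_anti state_le_trans.

End ProductOrder.

Inductive event n (C : 'I_n -> nat) : Type :=
| Arrival (A : {set 'I_n}) of A != set0
| Service (i : 'I_n) (j : nat) of (1 <= j <= C i)%N.

(** [svc_order i k] is the state l_i^(k) of queue [i]: a permutation of
    {0, ..., C_i} listing the states by nondecreasing service rate. *)
Record ato_pos (R : realType) (n : nat) := AtoPos {
  cap : 'I_n -> nat;
  mu : forall i, 'I_(cap i).+1 -> R;
  svc_order : forall i, {perm 'I_(cap i).+1};
  cap_gt0 : forall i, (0 < cap i)%N;
  mu_ge0 : forall i (x : 'I_(cap i).+1), 0 <= mu x;
  mu_0 : forall i, mu (ord0 : 'I_(cap i).+1) = 0;
  mu_gt0 : forall i (x : 'I_(cap i).+1), (1 <= x)%N -> 0 < mu x;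
  mu_svc_order_0 : forall i, mu (svc_order i ord0) = 0;
  mu_svc_order_le : forall i (j k : 'I_(cap i).+1), (j <= k)%N ->
    mu (svc_order i j) <= mu (svc_order i k)
}.

Section Transition.
Variables (R : realType) (n : nat) (S : ato_pos R n).
Local Notation C := (cap S).
Implicit Types x : state C.

Definition unit_vec (k : 'I_n) : 'rV[int]_n := delta_mx 0 k.

Definition fP_vec x (a : event C) : 'rV[int]_n :=
  match a with
  | Arrival A _ =>
      state_vec x + \sum_(k in A) (x 0 k < (C k)%:Z)%R%:R *: unit_vec k
  | Service i j _ =>
      state_vec x
      - \sum_(k < (C i).+1 | (j <= k)%N)
          (x 0 i == (svc_order S i k)%:Z)%:R *: unit_vec i
  end.

Lemma fP_vec_in_box x a : in_box C (fP_vec x a).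
Proof.
have /forallP xC := state_in_box x.
case: a => [A A0|i j jC]; rewrite /fP_vec; apply/forallP => q;
  have /andP[xq_ge0 xq_le] := xC q; rewrite !mxE summxE.
  have [qA|qA] := boolP (q \in A).
    rewrite (bigD1 q) //= big1 => [|k /andP[_ kq]].
      rewrite !mxE !eqxx mulr1 addr0; case: ltP => [xq_lt|_].
        by rewrite addr_ge0 //= lezD1.
      by rewrite addr0 xq_ge0.
    by rewrite !mxE eqxx eq_sym (negPf kq) mulr0.
  rewrite big1 ?addr0 ?xq_ge0 // => k kA.
  by rewrite !mxE eqxx; case: eqP qA => [->|_ _]; rewrite ?kA ?mulr0.
have /andP[j_gt0 _] := jC.
have [->|qi] := eqVneq q i; last first.
  rewrite big1 ?subr0 ?xq_ge0 // => k _.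
  by rewrite !mxE eqxx (negPf qi) mulr0.
have /andP[xi_ge0 xi_le] := xC i.
have [k0 /andP[jk0 /eqP xk0]|none] :=
    pickP (fun k : 'I_(C i).+1 => (j <= k)%N && (x 0 i == (svc_order S i k)%:Z)).
  rewrite (bigD1 k0) //= big1 => [|k /andP[_ kk0]]; last first.
    rewrite !mxE xk0 eqz_nat; case: eqP => [/val_inj/perm_inj k0k|_].
      by rewrite k0k eqxx in kk0.
    by rewrite mul0r.
  rewrite !mxE xk0 !eqxx mulr1 addr0.
  have l_gt0 : (0 < svc_order S i k0)%N.
    rewrite lt0n; apply/negP => /eqP l0.
    have l00 : svc_order S i ord0 = ord0.
      apply/val_inj/eqP => /=; rewrite -leqn0 leqNgt; apply/negP.
      by move=> /mu_gt0; rewrite mu_svc_order_0 ltxx.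
    have k00 : k0 = ord0.
      by apply: (@perm_inj _ (svc_order S i)); rewrite l00; apply: val_inj.
    by move: jk0; rewrite k00 leqn0 => /eqP j0; rewrite j0 in j_gt0.
  rewrite subr_ge0 lez_nat l_gt0 /= (le_trans _ xi_le) // xk0.
  by rewrite lerBlDr lerDl.
rewrite big1 ?subr0 ?xi_ge0 // => k jk.
by have := none k; rewrite jk /= !mxE => ->; rewrite mul0r.
Qed.

Definition fP x (a : event C) : state C := State (fP_vec_in_box x a).

End Transition.

(* Main.v *)
(** An event changes each coordinate by at most one, in a direction fixed by the
    event, and by an amount that depends only on that coordinate. So where [x]
    and [y] agree they move together, and where [x] is strictly smaller the
    integer gap of at least one absorbs the move. *)
Require Import Defs.
From mathcomp Require Import all_boot all_order all_fingroup all_algebra reals.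
Import Order.TTheory GRing.Theory Num.Theory.

Lemma homo_add_bool (d : int -> bool) :
  {homo (fun z : int => z + (d z)%:R)%R : z t / (z <= t)%R}.
Proof.
move=> z t; rewrite le_eqVlt => /predU1P[->//|zt].
apply: (@le_trans _ _ t); last by rewrite lerDl ler0n.
by case: (d z); rewrite ?addr0 ?lezD1 // ltW.
Qed.

(** [d] is arbitrary because the service indicator, read off [svc_order], need not be monotone in
    the state. *)
Lemma homo_sub_bool (d : int -> bool) :
  {homo (fun z : int => z - (d z)%:R)%R : z t / (z <= t)%R}.
Proof.
move=> z t; rewrite le_eqVlt => /predU1P[->//|zt].
apply: (@le_trans _ _ z); first by rewrite gerBl ler0n.
by rewrite lerBrDr; case: (d t); rewrite ?addr0 ?lezD1 // ltW.
Qed.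

Section Coordinates.
Variables (R : realType) (n : nat) (S : ato_pos R n).
Implicit Types (x : state (cap S)) (q : 'I_n).
Local Open Scope ring_scope.

Lemma fP_arrivalE x (A : {set 'I_n}) (A0 : A != set0) q :
  fP_vec x (Arrival (cap S) A0) 0 q
  = x 0 q + ((q \in A) && (x 0 q < (cap S q)%:Z))%:R.
Proof.
rewrite !mxE summxE; congr (_ + _); have [qA|qA] := boolP (q \in A).
  rewrite (bigD1 q) //= big1 => [|k /andP[_ kq]].
    by rewrite !mxE !eqxx mulr1 addr0 natz.
  by rewrite !mxE eqxx eq_sym (negPf kq) mulr0.
by rewrite big1 // => k kA; rewrite !mxE eq_sym (negPf (memPn qA k kA)) mulr0.
Qed.

(** A permutation lists each state once, so at most one term of the sum is nonzero and the sum
    collapses to a boolean. Testing [x 0 q] instead of [x 0 i], harmless under [q == i], makes the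
    decrement a function of coordinate [q] alone. *)
Lemma fP_serviceE x (i : 'I_n) (j : nat) (jC : (1 <= j <= cap S i)%N) q :
  fP_vec x (@Service _ (cap S) i j jC) 0 q
  = x 0 q - ((q == i) && [exists k : 'I_(cap S i).+1,
      (j <= k)%N && (x 0 q == (svc_order S i k)%:Z)])%:R.
Proof.
rewrite !mxE summxE; congr (_ - _); have [->|qi] := eqVneq q i; last first.
  by rewrite big1 // => k _; rewrite !mxE (negPf qi) andbF mulr0.
case: existsP => [[k0 /andP[jk0 /eqP xk0]]|none].
  rewrite (bigD1 k0) //= big1 => [|k /andP[_ kk0]].
    by rewrite !mxE xk0 !eqxx mulr1 addr0.
  (* A rank other than [k0] holds a different state. *)
  rewrite xk0 eqz_nat (inj_eq val_inj) (inj_eq perm_inj) eq_sym (negPf kk0).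
  by rewrite scale0r mxE.
rewrite big1 // => k jk; case: eqP => [xk|_]; last by rewrite scale0r mxE.
by case: none; exists k; rewrite jk xk eqxx.
Qed.

End Coordinates.

Theorem proposition6 (R : realType) (n : nat) (n_gt0 : (0 < n)%N)
    (S : ato_pos R n) (a : event (cap S)) (x y : state (cap S)) :
  (x <= y)%O -> (fP x a <= fP y a)%O.
Proof.
move=> /forallP xy; apply/forallP => q.
change (fP_vec x a 0%R q <= fP_vec y a 0%R q)%R.
case: a => [A A0|i j jC].
  rewrite !fP_arrivalE.
  (* The same indicator [d] serves both [x] and [y]. *)
  exact: (homo_add_bool (fun z => (q \in A) && (z < (cap S q)%:Z)%R)).
rewrite !fP_serviceE.
exact: (homo_sub_bool (fun z => (q == i) && [exists k : 'I_(cap S i).+1,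
  (j <= k)%N && (z == (svc_order S i k)%:Z)%R])).
Qed.
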